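(* Let $f_0\colon\mathbb{R}^n\to\mathbb{R}$ and $F\colon\mathbb{R}^n\to\mathbb{R}^m$ be twice continuously differentiable, let $C\subset\mathbb{R}^m$ be closed, and consider the problem $\min\{f_0(x)\mid F(x)\in C\}$. Let $\bar x\in\mathbb{R}^n$ be feasible, i.e. $F(\bar x)\in C$. Assume that for each $u\in\mathcal{C}(\bar x)\setminus\{0\}$ there are $\alpha\ge0$ and a multiplier $\lambda\in\Lambda^\alpha(\bar x)$ such that $$\nabla^2_{xx}L^\alpha(\bar x,\lambda)(u,u)+\mathrm{d}^2\delta_C(F(\bar x);\lambda)(\nabla F(\bar x)u)>0.$$ Then $\bar x$ is an essential local minimizer of second order for this problem.
   Context: For $\alpha\ge0$: $L^\alpha(x,\lambda):=\alpha f_0(x)+\langle\lambda,F(x)\rangle$ on $\mathbb{R}^n\times\mathbb{R}^m$, and $\Lambda^\alpha(\bar x):=\{\lambda\in\mathbb{R}^m\mid\nabla_xL^\alpha(\bar x,\lambda)=0\}$. The critical cone is $\mathcal{C}(\bar x):=\{u\in\mathbb{R}^n\mid\nabla F(\bar x)u\in T_C(F(\bar x)),\ \langle\nabla f_0(\bar x),u\rangle\le0\}$, where $T_C(\bar y):=\{v\mid\exists t_k\downarrow0,\,v_k\to v\colon\bar y+t_kv_k\in C\ \forall k\}$. For a Hessian, $\nabla^2_{xx}L^\alpha(\bar x,\lambda)(u,u):=u^\top\nabla^2_{xx}L^\alpha(\bar x,\lambda)u$. $\delta_C$ is the indicator function of $C$ ($0$ on $C$, $+\infty$ off $C$), and the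 second subderivative of $h$ at $\bar z$ (with $|h(\bar z)|<\infty$) for $z^*$ is $\mathrm{d}^2h(\bar z;z^* )(w):=\liminf_{t\downarrow0,\,w'\to w}\frac{h(\bar z+tw')-h(\bar z)-t\langle z^*,w'\rangle}{\frac12t^2}\in[-\infty,\infty]$. A point $\bar x$ is an essential local minimizer of second order for $\min\{f_0(x)\mid F(x)\in C\}$ if $F(\bar x)\in C$ and there exist $\varepsilon>0$ and $\delta>0$ such that $\max\{f_0(x)-f_0(\bar x),\operatorname{dist}(F(x),C)\}\ge\varepsilon\|x-\bar x\|^2$ for all $x$ with $\|x-\bar x\|\le\delta$ (Euclidean norm and distance). *)

(* Defs.v *)
(* Vectors of R^n are row vectors, so that nabla F(x) u is [u *m 'J F x] and
   the quadratic form of a Hessian H is [u *m H *m u^T]. The library norm of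
   ['rV[R]_n] is the sup norm: topological notions (closedness, limits,
   differentiability) use it, metric ones use [enorm] below. *)
From HB Require Import structures.
From mathcomp Require Import all_boot all_order all_algebra.
From mathcomp Require Import all_classical all_reals all_analysis.

Set Implicit Arguments.
Unset Strict Implicit.
Unset Printing Implicit Defensive.

Import Order.TTheory GRing.Theory Num.Theory.
Import numFieldNormedType.Exports.

Local Open Scope classical_set_scope.
Local Open Scope ring_scope.

Definition dot (R : realType) (n : nat) (u v : 'rV[R]_n) : R :=
  \sum_i u 0 i * v 0 i.

Definition enorm (R : realType) (n : nat) (u : 'rV[R]_n) : R :=
  Num.sqrt (dot u u).

(* For empty A the infimum is the junk value [inf set0 = 0]. *)
Definition edist (R : realType) (n : nat) (y : 'rV[R]_n)
    (A : set 'rV[R]_n) : R :=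
  inf [set enorm (y - c) | c in A].

Definition partial (R : realType) (n : nat) (W : normedModType R)
    (i : 'I_n) (f : 'rV[R]_n -> W) (x : 'rV[R]_n) : W :=
  'D_(delta_mx 0 i) f x.

Definition twice_continuously_differentiable (R : realType) (n : nat)
    (W : normedModType R) (f : 'rV[R]_n -> W) : Prop :=
  [/\ forall x, differentiable f x,
      forall i x, differentiable (partial i f) x
    & forall i j, continuous (partial i (partial j f))].

Definition grad (R : realType) (n : nat) (f : 'rV[R]_n -> R)
    (x : 'rV[R]_n) : 'rV[R]_n :=
  \row_i partial i f x.

Definition hess (R : realType) (n : nat) (f : 'rV[R]_n -> R)
    (x : 'rV[R]_n) : 'M[R]_n :=
  \matrix_(i, j) partial i (partial j f) x.

Definition quad_form (R : realType) (n : nat) (H : 'M[R]_n)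
    (u : 'rV[R]_n) : R :=
  (u *m H *m u^T) 0 0.

Definition lagrangian (R : realType) (n m : nat) (f0 : 'rV[R]_n -> R)
    (F : 'rV[R]_n -> 'rV[R]_m) (alpha : R) (x : 'rV[R]_n)
    (lambda : 'rV[R]_m) : R :=
  alpha * f0 x + dot lambda (F x).

Definition multipliers (R : realType) (n m : nat) (f0 : 'rV[R]_n -> R)
    (F : 'rV[R]_n -> 'rV[R]_m) (alpha : R) (x : 'rV[R]_n) :
    set 'rV[R]_m :=
  [set lambda | grad (lagrangian f0 F alpha ^~ lambda) x = 0].

(* t_k \downarrow 0 is read as t_k > 0 and t_k --> 0. *)
Definition tangent_cone (R : realType) (m : nat) (C : set 'rV[R]_m)
    (y : 'rV[R]_m) : set 'rV[R]_m :=
  [set v | exists t : nat -> R, exists w : nat -> 'rV[R]_m,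
    [/\ forall k, 0 < t k,
        t @ \oo --> (0 : R),
        w @ \oo --> v
      & forall k, C (y + t k *: w k)]].

Definition critical_cone (R : realType) (n m : nat) (f0 : 'rV[R]_n -> R)
    (F : 'rV[R]_n -> 'rV[R]_m) (C : set 'rV[R]_m) (x : 'rV[R]_n) :
    set 'rV[R]_n :=
  [set u | tangent_cone C (F x) (u *m 'J F x) /\ dot (grad f0 x) u <= 0].

Definition indicator (R : realType) (m : nat) (C : set 'rV[R]_m)
    (y : 'rV[R]_m) : \bar R :=
  if y \in C then 0%E else +oo%E.

(* The pair p = (t, w') tends to (0, w) with t > 0; w' = w is allowed. *)
Definition second_subderivative (R : realType) (m : nat)
    (h : 'rV[R]_m -> \bar R) (z zs w : 'rV[R]_m) : \bar R :=
  limf_einf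
    (fun p : R * 'rV[R]_m =>
      ((h (z + p.1 *: p.2)%R - h z - (p.1 * dot zs p.2)%:E)
        * ((2^-1 * p.1 ^+ 2)^-1)%:E)%E)
    (filter_prod (0 : R)^'+ (nbhs w)).

Definition essential_local_minimizer2 (R : realType) (n m : nat)
    (f0 : 'rV[R]_n -> R) (F : 'rV[R]_n -> 'rV[R]_m) (C : set 'rV[R]_m)
    (xbar : 'rV[R]_n) : Prop :=
  C (F xbar) /\
  exists eps : R, exists delta : R,
    [/\ 0 < eps, 0 < delta &
      forall x : 'rV[R]_n, enorm (x - xbar) <= delta ->
        eps * enorm (x - xbar) ^+ 2
          <= Num.max (f0 x - f0 xbar) (edist (F x) C)].

(* Main.v *)
Require Import Defs.
From HB Require Import structures.
From mathcomp Require Import all_boot all_order all_algebra.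
From mathcomp Require Import all_classical all_reals all_analysis ring lra.

Import Order.TTheory GRing.Theory Num.Theory.
Import numFieldNormedType.Exports.

Local Open Scope classical_set_scope.
Local Open Scope ring_scope.

(** The theorem is proved by contradiction and compactness. If [xbar] is not an
    essential local minimizer of second order, then at every scale some point
    violates the growth inequality: there are [x_k --> xbar], [x_k != xbar], and
    [y_k] in [C] with [f0 x_k - f0 xbar] and [|F x_k - y_k|] both bounded above
    by an [o(t_k ^+ 2)], where [t_k = |x_k - xbar|]. The directions [v_k = (x_k - xbar) / t_k] lie on
    the unit sphere, so along a subsequence they tend to some [u != 0]
    ([violating_sequence]).

    To first order these bounds vanish, hence [u] is critical: the points
    [y_k = F xbar + t_k w_k] of [C] satisfy [w_k --> u *m 'J F xbar], so this
    vector is tangent to [C] ([tangent_direction_cvg]), and the slope of [f0]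
    along [u] is nonpositive ([derive_le0]).

    To second order the violations contradict the hypothesis. Let [alpha, lambda] be the
    multipliers that it provides for [u], and [L] the Lagrangian. Then
    [L x_k - L xbar <= t_k <lambda, w_k> + o(t_k ^+ 2)]. Divided by
    [t_k ^+ 2 / 2], the left side tends to the Hessian form of [L] at [u],
    because the gradient of [L] vanishes ([second_order_quotient_cvg]). Since
    [y_k] is in [C], the number [- t_k <lambda, w_k> / (t_k ^+ 2 / 2)] is a
    value of the difference quotient that defines the second subderivative, so
    it is eventually at least a constant [c] larger than minus the Hessian form
    ([second_subderivative_gt]). In the limit the Hessian form is at most
    [- c], which is absurd.

    All estimates are made in the sup norm, for which the limits are taken; the
    Euclidean norm is traded for it once, in [violating_points]. *)

Set Implicit Arguments.
Unset Strict Implicit.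
Unset Printing Implicit Defensive.

Implicit Types (R : realType) (n m : nat).

(** * Dot product and Euclidean norm *)

Lemma dotE R m (l y : 'rV[R]_m) : dot l y = (y *m l^T) 0 0.
Proof. by rewrite mxE; apply: eq_bigr => i _; rewrite mxE mulrC. Qed.

Lemma dot_is_linear R m (l : 'rV[R]_m) : linear (dot l : 'rV[R]_m -> R).
Proof. by move=> a x y; rewrite !dotE mulmxDl -scalemxAl !mxE. Qed.

HB.instance Definition _ R m (l : 'rV[R]_m) :=
  GRing.isLinear.Build R 'rV[R]_m R _ (dot l) (@dot_is_linear R m l).

Lemma differentiable_dot R m (l y : 'rV[R]_m) :
  differentiable (dot l : 'rV[R]_m -> R) y.
Proof.
have -> : dot l = \sum_i (l 0 i \*: (fun y : 'rV[R]_m => y 0 i : R)).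
  by apply/funext => z; rewrite fct_sumE.
apply: differentiable_sum => i; apply: differentiableZ.
exact: differentiable_coord.
Qed.

Lemma continuous_dot R m (l : 'rV[R]_m) : continuous (dot l).
Proof. by move=> y; exact: (differentiable_continuous (differentiable_dot l y)). Qed.

(** The sup norm is dual to the l1 norm of the coefficients. *)
Lemma normr_dot_le R m (l z : 'rV[R]_m) :
  `|dot l z| <= (\sum_i `|l 0 i|) * `|z|.
Proof.
rewrite mulr_suml; apply: le_trans (ler_norm_sum _ _ _) _.
apply: ler_sum => i _; rewrite normrM ler_wpM2l//.
rewrite [leRHS]/Num.norm/= mx_normrE.
by apply: le_trans (le_bigmax _ _ (0, i)) => /=.
Qed.

Lemma enorm_ge0 R n (u : 'rV[R]_n) : 0 <= enorm u.
Proof. exact: sqrtr_ge0. Qed.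

Lemma dot_self_ge0 R n (u : 'rV[R]_n) : 0 <= dot u u.
Proof. by apply: sumr_ge0 => i _; rewrite -expr2 sqr_ge0. Qed.

Lemma enorm_sqr R n (u : 'rV[R]_n) : enorm u ^+ 2 = dot u u.
Proof. by rewrite sqr_sqrtr// dot_self_ge0. Qed.

Lemma norm_le_enorm R n (u : 'rV[R]_n) : `|u| <= enorm u.
Proof.
rewrite [leLHS]/Num.norm/= mx_normrE; apply: bigmax_le => [|[i j] _ /=].
  exact: enorm_ge0.
rewrite -(@ler_pXn2r _ 2) ?nnegrE ?enorm_ge0// enorm_sqr ord1 /dot.
rewrite (bigD1 j)//= real_normK ?num_real// expr2 lerDl.
by apply: sumr_ge0 => k _; rewrite -expr2 sqr_ge0.
Qed.

Lemma enorm_sqr_le R n (u : 'rV[R]_n) : enorm u ^+ 2 <= n.+1%:R * `|u| ^+ 2.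
Proof.
rewrite enorm_sqr; apply: le_trans (ler_norm _) _.
apply: le_trans (normr_dot_le u u) _.
rewrite expr2 mulrA ler_wpM2r//.
apply: (@le_trans _ _ (\sum_(i < n) `|u|)).
  apply: ler_sum => i _; rewrite [leRHS]/Num.norm/= mx_normrE.
  by apply: le_trans (le_bigmax _ _ (0, i)) => /=.
by rewrite sumr_const card_ord -[leLHS]mulr_natl ler_wpM2r// ler_nat.
Qed.

(** * First- and second-order expansions along a sequence *)

(** Fréchet differentiability allows the direction to vary with the step, which
    the definition of ['D_u f x] as a limit along a fixed ray does not. *)
Lemma diff_quotient_cvg R n (W : normedModType R) (f : 'rV[R]_n -> W)
    (x u : 'rV[R]_n) (t : nat -> R) (v : nat -> 'rV[R]_n) :
  differentiable f x -> (forall k, 0 < t k) -> t @ \oo --> (0 : R) ->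
  v @ \oo --> u ->
  (fun k => (t k)^-1 *: (f (x + t k *: v k) - f x)) @ \oo --> 'D_u f x.
Proof.
move=> df t0 tc vc; rewrite deriveE//.
have vtc : (fun k => t k *: v k) @ \oo --> (0 : 'rV[R]_n).
  by rewrite -(scale0r u); apply: cvgZ.
have /eqaddoP littleo := diff_locally df.
apply/cvgrPdist_lt => e e0.
have e20 : 0 < e / 2 by rewrite divr_gt0.
have M0 : 0 < `|u| + 1 by rewrite ltr_wpDl.
have d0 : 0 < e / 2 / (`|u| + 1) by rewrite divr_gt0.
have := vtc _ (littleo _ d0) => /=.
have /cvgrPdist_lt/(_ _ e20) : (fun k => 'd f x (v k)) @ \oo --> 'd f x u.
  by apply: continuous_cvg => //; exact: diff_continuous.
(* Eventually [`|v k| <= `|u| + 1]; the little-o constant is scaled by this. *)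
have /cvgrPdist_lt/(_ _ ltr01) := vc.
move=> nu nd no; near=> k.
have tk := t0 k.
have -> : (t k)^-1 *: (f (x + t k *: v k) - f x) =
  'd f x (v k) + (t k)^-1 *: ((f \o shift x) (t k *: v k)
      - (f x + 'd f x (t k *: v k))).
  have {1}-> : 'd f x (v k) = (t k)^-1 *: 'd f x (t k *: v k).
    by rewrite linearZ scalerA mulVf ?gt_eqF// scale1r.
  rewrite -scalerDr; congr (_ *: _).
  by rewrite opprD (addrA (f _)) (addrC ('d f x _)) subrK /= (addrC (_ *: _)).
rewrite opprD addrA; apply: le_lt_trans (ler_normB _ _) _.
rewrite (splitr e) ltr_leD//; first by near: k.
rewrite normrZ normfV gtr0_norm// mulrC ler_pdivrMr//.
apply: (@le_trans _ _ (e / 2 / (`|u| + 1) * `|t k *: v k|)); first by near: k.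
rewrite normrZ gtr0_norm// (mulrC (t k)) mulrA ler_wpM2r ?(ltW tk)//.
rewrite -mulrA ler_piMr ?(ltW e20)// mulrC ler_pdivrMr// mul1r.
have -> : v k = u - (u - v k) by rewrite subKr.
apply: le_trans (ler_normB _ _) _; rewrite lerD2l ltW//; near: k; exact: nu.
Unshelve. all: by end_near. Qed.

Lemma is_derive_ray R n (W : normedModType R) (f : 'rV[R]_n -> W)
    (x v : 'rV[R]_n) (s : R) :
  differentiable f (x + s *: v) ->
  is_derive s 1 (fun r : R => f (x + r *: v)) ('D_v f (x + s *: v)).
Proof.
move=> df.
(* Both difference quotients are the same function of [h]. *)
have E : (fun h : R => h^-1 *: (f (x + (h *: 1 + s) *: v) - f (x + s *: v)))
       = (fun h : R => h^-1 *: (f (h *: v + (x + s *: v)) - f (x + s *: v))).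
  apply/funext => h; congr (_ *: (f _ - _)).
  by rewrite scalerDl addrCA /= [h *: 1]mulr1.
have D : derivable f (x + s *: v) v by exact: diff_derivable.
by split; rewrite /derivable /derive E.
Qed.

Lemma derive_sum_partial R n (W : normedModType R) (f : 'rV[R]_n -> W)
    (x v : 'rV[R]_n) :
  differentiable f x -> 'D_v f x = \sum_i v 0 i *: partial i f x.
Proof.
move=> df; rewrite deriveE// {1}(row_sum_delta v) linear_sum.
by apply: eq_bigr => i _; rewrite linearZ /= /partial deriveE.
Qed.

Lemma quad_formE R n (H : 'M[R]_n) (u : 'rV[R]_n) :
  quad_form H u = \sum_i u 0 i * \sum_j u 0 j * H j i.
Proof.
rewrite /quad_form mxE; apply: eq_bigr => i _.
by rewrite !mxE mulrC.
Qed.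

Lemma coord_cvg R n (v : nat -> 'rV[R]_n) (u : 'rV[R]_n) (i : 'I_n) :
  v @ \oo --> u -> (fun k => v k 0 i) @ \oo --> u 0 i.
Proof.
move=> vu; apply: (cvg_comp v (fun w : 'rV[R]_n => w 0 i) vu).
exact: coord_continuous.
Qed.

Lemma quad_form_cvg R n (H : 'M[R]_n) (u : 'rV[R]_n) (v : nat -> 'rV[R]_n) :
  v @ \oo --> u -> (fun k => quad_form H (v k)) @ \oo --> quad_form H u.
Proof.
move=> vu; have vui i : (fun k => v k 0 i) @ \oo --> u 0 i.
  exact: coord_cvg.
rewrite quad_formE; under eq_fun do rewrite quad_formE.
apply: cvg_big => [|i _]; first exact: add_continuous.
apply: cvgM => //; apply: cvg_big => [|j _]; first exact: add_continuous.
by apply: cvgM => //; exact: cvg_cst.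
Qed.

Lemma dot_grad R n (f : 'rV[R]_n -> R) (x u : 'rV[R]_n) :
  differentiable f x -> dot (grad f x) u = 'D_u f x.
Proof.
move=> df; rewrite derive_sum_partial//; apply: eq_bigr => i _.
by rewrite mxE mulrC.
Qed.

(** The mean value theorem for [r |-> f (x + r *: v) - r ^+ 2 / 2 * q] on
    [[0, t]]. Subtracting the quadratic term before applying it leaves only
    first-order information on the derivatives of [f] to be used at [s]. *)
Lemma mean_value_quadratic R n (f : 'rV[R]_n -> R) (x v : 'rV[R]_n) (t q : R) :
  (forall y, differentiable f y) -> 0 < t ->
  exists2 s, 0 < s < t &
    f (x + t *: v) - f x - t ^+ 2 / 2 * q = ('D_v f (x + s *: v) - s * q) * t.
Proof.
move=> df t0.
pose g := (fun r : R => f (x + r *: v)) - (q / 2) \*: (@id R) ^+ 2.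
pose dg s := 'D_v f (x + s *: v) - s * q.
have gd s : is_derive s (1 : R) g (dg s).
  have := is_derive_ray (df (x + s *: v)) => ?.
  apply: is_derive_eq; congr (_ - _).
  by rewrite /GRing.scale/= expr1; field.
have [|s] := MVT t0 (fun s _ => gd s).
  apply: derivable_within_continuous => s _.
  exact: (@ex_derive _ _ _ _ _ _ _ (gd s)).
rewrite in_itv/= subr0 => st E; exists s => //.
rewrite -/(dg s) -E /g !fctE /= scale0r addr0.
rewrite /GRing.scale/= !expr2; lra.
Qed.

(** Let [s_k] in [(0, t_k)] be the point of [mean_value_quadratic] for the
    direction [v_k]. The error relative to [quad_form (hess f x) (v_k)] is
    [2 s_k / t_k], which is at most 2, times
    ['D_(v_k) f (x + s_k v_k) / s_k - quad_form (hess f x) (v_k)], which tends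
    to 0 because the gradient vanishes at [x] and is differentiable there. *)
Lemma second_order_quotient_cvg R n (f : 'rV[R]_n -> R)
    (x u : 'rV[R]_n) (t : nat -> R) (v : nat -> 'rV[R]_n) :
  (forall y, differentiable f y) ->
  (forall i, differentiable (partial i f) x) ->
  grad f x = 0 ->
  (forall k, 0 < t k) -> t @ \oo --> (0 : R) -> v @ \oo --> u ->
  (fun k => (f (x + t k *: v k) - f x) / (2^-1 * t k ^+ 2)) @ \oo
    --> quad_form (hess f x) u.
Proof.
move=> df dpf gf0 t0 tc vu.
pose q := quad_form (hess f x).
have pf0 i : partial i f x = 0 by have /rowP/(_ i) := gf0; rewrite !mxE.
have /(@choice _ _ _)[s sP] : forall k, exists s, 0 < s < t k /\
    f (x + t k *: v k) - f x - t k ^+ 2 / 2 * q (v k)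
      = ('D_(v k) f (x + s *: v k) - s * q (v k)) * t k.
  by move=> k; have [s ? ?] := mean_value_quadratic x (v k) (q (v k)) df (t0 k);
     exists s.
have s0 k : 0 < s k by have [/andP[]] := sP k.
have sc : s @ \oo --> (0 : R).
  apply: (squeeze_cvgr _ (cvg_cst 0) tc).
  by near=> k; have [/andP[? ?] _] := sP k; rewrite !ltW.
pose e k := 'D_(v k) f (x + s k *: v k) / s k - q (v k).
have ec : e @ \oo --> (0 : R).
  rewrite -(subrr (q u)); apply: cvgB; last exact: quad_form_cvg.
  rewrite /q quad_formE.
  have -> : (fun k => 'D_(v k) f (x + s k *: v k) / s k) = (fun k =>
      \sum_i v k 0 i * ((s k)^-1 *: (partial i f (x + s k *: v k) - partial i f x))).
    apply/funext => k; rewrite derive_sum_partial// mulr_suml.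
    by apply: eq_bigr => i _; rewrite pf0 subr0 -mulrA [_ / s k]mulrC.
  apply: cvg_big => [|i _]; first exact: add_continuous.
  apply: cvgM; first exact: coord_cvg.
  have -> : \sum_j u 0 j * hess f x j i = 'D_u (partial i f) x.
    by rewrite derive_sum_partial//; apply: eq_bigr => j _; rewrite mxE.
  exact: diff_quotient_cvg.
rewrite -[X in _ --> X]addr0.
have -> : (fun k => (f (x + t k *: v k) - f x) / (2^-1 * t k ^+ 2)) =
    (fun k => q (v k) + s k / t k * 2 * e k).
  apply/funext => k; have [_ /eqP] := sP k.
  rewrite subr_eq => /eqP ->; rewrite /e; field.
  by rewrite !gt_eqF.
apply: cvgD; first exact: quad_form_cvg.
apply/norm_cvg0P.
have : (fun k => 2 * `|e k|) @ \oo --> (0 : R).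
  rewrite -(mulr0 2); apply: cvgM; first exact: cvg_cst.
  by rewrite -(normr0 R); apply: cvg_norm.
apply: (squeeze_cvgr _ (cvg_cst 0)).
near=> k; rewrite normr_ge0 /= normrM ler_wpM2r//.
have [/andP[_ st] _] := sP k.
rewrite ger0_norm; last by rewrite mulr_ge0// divr_ge0// ltW.
by rewrite ler_piMl// ler_pdivrMr// mul1r ltW.
Unshelve. all: by end_near. Qed.

(** * Derivatives of the Lagrangian *)

Lemma dot_comp_diff R n m (l : 'rV[R]_m) (F : 'rV[R]_n -> 'rV[R]_m) (x : 'rV[R]_n) :
  differentiable F x -> differentiable (dot l \o F) x /\
    forall v, 'D_v (dot l \o F) x = dot l ('D_v F x).
Proof.
move=> dF; have dc : differentiable (dot l \o F) x.
  by apply: differentiable_comp => //; exact: differentiable_dot.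
split=> // v; rewrite !deriveE// diff_comp//; last exact: differentiable_dot.
by rewrite /= diff_lin//; exact: continuous_dot.
Qed.

Lemma lagrangianE R n m (f0 : 'rV[R]_n -> R) (F : 'rV[R]_n -> 'rV[R]_m) a l :
  lagrangian f0 F a ^~ l = a \*: f0 + (dot l \o F).
Proof. by []. Qed.

Lemma lagrangian_diff R n m (f0 : 'rV[R]_n -> R) (F : 'rV[R]_n -> 'rV[R]_m)
    (a : R) (l : 'rV[R]_m) (x : 'rV[R]_n) :
  differentiable f0 x -> differentiable F x ->
  differentiable (lagrangian f0 F a ^~ l) x.
Proof.
move=> df dF; rewrite lagrangianE; apply: differentiableD.
  exact: differentiableZ.
exact: (dot_comp_diff l dF).1.
Qed.

(** A partial derivative of a Lagrangian is the Lagrangian of the partial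
    derivatives, so [lagrangian_diff] also settles its differentiability. *)
Lemma partial_lagrangian R n m (f0 : 'rV[R]_n -> R)
    (F : 'rV[R]_n -> 'rV[R]_m) (a : R) (l : 'rV[R]_m) (i : 'I_n) :
  (forall x, differentiable f0 x) -> (forall x, differentiable F x) ->
  partial i (lagrangian f0 F a ^~ l) =
    lagrangian (partial i f0) (partial i F) a ^~ l.
Proof.
move=> df dF; apply/funext => x; have [dc Dc] := dot_comp_diff l (dF x).
rewrite /partial lagrangianE deriveD; first last.
- exact: diff_derivable.
- by apply: derivableZ; exact: diff_derivable.
by rewrite deriveZ ?Dc//; exact: diff_derivable.
Qed.

(** * Sequences that violate quadratic growth *)

(** Negating the growth condition with the constant [e / n.+1] instead of [e]
    absorbs the factor lost in passing from the Euclidean to the sup norm. *)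
Lemma violating_points R n m (f0 : 'rV[R]_n -> R)
    (F : 'rV[R]_n -> 'rV[R]_m) (C : set 'rV[R]_m) (x0 : 'rV[R]_n) :
  C (F x0) -> ~ essential_local_minimizer2 f0 F C x0 ->
  forall e : R, 0 < e -> exists x y,
    [/\ x != x0, C y, `|x - x0| <= e,
        f0 x - f0 x0 <= e * `|x - x0| ^+ 2
      & `|F x - y| <= e * `|x - x0| ^+ 2].
Proof.
move=> CF ness e e0; apply: contrapT => none; apply: ness; split=> //.
have n0 : 0 < n.+1%:R :> R by rewrite ltr0n.
exists (e / n.+1%:R), e; split=> //; first exact: divr_gt0.
move=> x xe; rewrite leNgt gt_max; apply/negP => /andP[fx Fx].
have hasC : [set enorm (F x - c) | c in C] !=set0.
  by exists (enorm (F x - F x0)), (F x0).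
have [_ [y Cy <-] dy] := inf_lt hasC Fx.
have bnd : e / n.+1%:R * enorm (x - x0) ^+ 2 <= e * `|x - x0| ^+ 2.
  by rewrite -mulrA ler_pM2l// mulrC ler_pdivrMr// mulrC enorm_sqr_le.
apply: none; exists x, y; split => //.
- (* At [x0] the growth inequality reads [0 <= dist], which cannot fail. *)
  apply: contraTneq dy => ->; rewrite subrr -leNgt.
  rewrite [enorm 0]/enorm /dot big1 ?sqrtr0 ?expr0n ?mulr0 ?enorm_ge0// => i _.
  by rewrite mxE mul0r.
- exact: le_trans (norm_le_enorm _) xe.
- exact: le_trans (ltW fx) bnd.
- exact: le_trans (norm_le_enorm _) (le_trans (ltW dy) bnd).
Qed.

(** Compactness of the unit sphere, the source of the limit direction. *)
Lemma unit_seq_cluster R n (v : nat -> 'rV[R]_n) :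
  (forall k, `|v k| = 1) -> exists2 u, `|u| = 1 & cluster (v @ \oo) u.
Proof.
move=> v1; pose S := [set w : 'rV[R]_n | `|w| = 1].
have Sc : compact S.
  apply: bounded_closed_compact.
    by exists 1; split => // M M1 w /= ->; exact: ltW.
  have -> : S = (fun w : 'rV[R]_n => `|w|) @^-1` [set 1] by [].
  apply: closed_comp; last exact: closed_eq.
  by move=> w _; exact: norm_continuous.
have [|u [Su cu]] := Sc (v @ \oo) _; last by exists u.
by exists 0 => // k _; exact: v1.
Qed.

(** The sequences have errors bounded by [harmonic k * t k ^+ 2], an explicit
    [o(t k ^+ 2)]. They come from a subsequence along which the normalized
    displacements converge; since the extraction satisfies [j <= phi j], it
    preserves these bounds. *)
Lemma violating_sequence R n m (f0 : 'rV[R]_n -> R)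
    (F : 'rV[R]_n -> 'rV[R]_m) (C : set 'rV[R]_m) (x0 : 'rV[R]_n) :
  C (F x0) -> ~ essential_local_minimizer2 f0 F C x0 ->
  exists (u : 'rV[R]_n) (t : nat -> R) (v : nat -> 'rV[R]_n)
    (y : nat -> 'rV[R]_m), [/\ u != 0, t @ \oo --> (0 : R), v @ \oo --> u,
      forall k, 0 < t k
    & forall k, [/\ C (y k),
        f0 (x0 + t k *: v k) - f0 x0 <= harmonic k * t k ^+ 2
      & `|F (x0 + t k *: v k) - y k| <= harmonic k * t k ^+ 2]].
Proof.
move=> CF ness.
have /choice[xy xyP] : forall k : nat, exists p : 'rV[R]_n * 'rV[R]_m,
    [/\ p.1 != x0, C p.2, `|p.1 - x0| <= harmonic k,
        f0 p.1 - f0 x0 <= harmonic k * `|p.1 - x0| ^+ 2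
      & `|F p.1 - p.2| <= harmonic k * `|p.1 - x0| ^+ 2].
  move=> k; have [x [y xyP]] := violating_points CF ness (harmonic_gt0 k).
  by exists (x, y).
pose r k := `|(xy k).1 - x0|.
have r0 k : 0 < r k by have [? _ _ _ _] := xyP k; rewrite normr_gt0 subr_eq0.
pose w k := (r k)^-1 *: ((xy k).1 - x0).
have w1 k : `|w k| = 1 by apply: normfZV; rewrite -normr_gt0; exact: r0.
have xE k : (xy k).1 = x0 + r k *: w k.
  by rewrite scalerA divff ?gt_eqF// scale1r addrC subrK.
have [u u1 clu] := unit_seq_cluster w1.
have /choice[phi phiP] : forall j : nat, exists k, (j <= k)%N /\
    `|u - w k| < harmonic j.
  move=> j.
  have [] := clu (w @` [set k | (j <= k)%N]) (ball u (harmonic j)).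
  - by exists j => // k jk; exists k.
  - exact: nbhsx_ballx (harmonic_gt0 j).
  by move=> _ [[k jk <-]]; rewrite -ball_normE /= => ?; exists k.
have hphi j : harmonic (phi j) <= harmonic j :> R.
  have [jk _] := phiP j.
  by rewrite lef_pV2 ?posrE ?ltr0n// ler_nat ltnS.
exists u, (r \o phi), (w \o phi), (fun j => (xy (phi j)).2).
split.
- by rewrite -normr_gt0 u1.
- apply: (squeeze_cvgr _ (cvg_cst 0) cvg_harmonic); near=> j.
  have [_ _ rj _ _] := xyP (phi j).
  by rewrite /= ltW ?r0//= (le_trans rj).
- apply/cvgrPdist_lt => e e0.
  have /cvgrPdist_lt/(_ _ e0) := @cvg_harmonic R.
  apply: filterS => j; rewrite sub0r normrN gtr0_norm ?harmonic_gt0// => je.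
  by have [_ wj] := phiP j; exact: lt_trans wj je.
- by move=> j; exact: r0.
- move=> j /=; rewrite -xE; have [_ Cy _ fj Fj] := xyP (phi j).
  by split => //; [apply: le_trans fj _|apply: le_trans Fj _];
    rewrite ler_wpM2r ?sqr_ge0.
Unshelve. all: by end_near. Qed.

(** * Limits along a violating sequence *)

(** A lower limit over the filter bounds from below every sequence converging
    along it. The constant [c] keeps the strict inequality available in the
    limit. *)
Lemma second_subderivative_gt R m (h : 'rV[R]_m -> \bar R) (z zs w : 'rV[R]_m)
    (q : R) (t : nat -> R) (ws : nat -> 'rV[R]_m) :
  (q%:E < second_subderivative h z zs w)%E ->
  (forall k, 0 < t k) -> t @ \oo --> (0 : R) -> ws @ \oo --> w ->
  exists2 c : R, q < c & \forall k \near \oo,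
    (c%:E <= (h (z + t k *: ws k)%R - h z - (t k * dot zs (ws k))%:E)
             * ((2^-1 * t k ^+ 2)^-1)%:E)%E.
Proof.
rewrite /second_subderivative limf_einfE => /ereal_sup_gt[_ [V VF <-] qV].
move=> t0 tc wc.
have [c qc cV] : exists2 c : R, q < c & (c%:E <= ereal_inf [set
    ((h (z + p.1 *: p.2)%R - h z - (p.1 * dot zs p.2)%:E)
        * ((2^-1 * p.1 ^+ 2)^-1)%:E)%E | p in V])%E.
  case: ereal_inf qV => [c|_|//]; first by rewrite lte_fin => ?; exists c.
  (* If the infimum is [+oo], any real above [q] will do. *)
  by exists (q + 1); rewrite ?ltrDl ?leey.
exists c => //.
have tc' : t @ \oo --> (0 : R)^'+.
  move=> A A0.
  exact: (filterS (fun k (tA : 0 < t k -> A (t k)) => tA (t0 k)) (tc _ A0)).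
have Vtw : \forall k \near \oo, V (t k, ws k) := cvg_pair tc' wc VF.
near=> k; apply: le_trans cV _.
apply: ereal_inf_lbound; exists (t k, ws k) => //; near: k.
exact: Vtw.
Unshelve. all: by end_near. Qed.

(** The correction from [F (x + t k *: v k)] to [y k] has order [t k ^+ 2], hence
    does not affect limits of difference quotients. *)
Lemma tangent_direction_cvg R n m (F : 'rV[R]_n -> 'rV[R]_m)
    (x u : 'rV[R]_n) (t : nat -> R) (v : nat -> 'rV[R]_n)
    (y : nat -> 'rV[R]_m) :
  differentiable F x -> (forall k, 0 < t k) -> t @ \oo --> (0 : R) ->
  v @ \oo --> u ->
  (forall k, `|F (x + t k *: v k) - y k| <= harmonic k * t k ^+ 2) ->
  (fun k => (t k)^-1 *: (y k - F x)) @ \oo --> 'D_u F x.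
Proof.
move=> dF t0 tc vu Fy.
have -> : (fun k => (t k)^-1 *: (y k - F x)) =
    (fun k => (t k)^-1 *: (F (x + t k *: v k) - F x)
              - (t k)^-1 *: (F (x + t k *: v k) - y k)).
  by apply/funext => k; rewrite -scalerBr opprB [X in _ = _ *: X]addrC subrKA.
rewrite -[X in _ --> X]subr0; apply: cvgB; first exact: diff_quotient_cvg.
apply/norm_cvg0P.
have ht0 : (fun k => harmonic k * t k) @ \oo --> (0 : R).
  by rewrite -(mulr0 0); apply: cvgM => //; exact: cvg_harmonic.
apply: (squeeze_cvgr _ (cvg_cst 0) ht0).
near=> k; rewrite normr_ge0 normrZ normfV gtr0_norm// mulrC ler_pdivrMr//.
by rewrite -mulrA -expr2 Fy.
Unshelve. all: by end_near. Qed.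

Lemma derive_le0 R n (f : 'rV[R]_n -> R)
    (x u : 'rV[R]_n) (t : nat -> R) (v : nat -> 'rV[R]_n) :
  differentiable f x -> (forall k, 0 < t k) -> t @ \oo --> (0 : R) ->
  v @ \oo --> u ->
  (forall k, f (x + t k *: v k) - f x <= harmonic k * t k ^+ 2) ->
  'D_u f x <= 0.
Proof.
move=> df t0 tc vu fh.
have ht0 : (fun k => harmonic k * t k) @ \oo --> (0 : R).
  by rewrite -(mulr0 0); apply: cvgM => //; exact: cvg_harmonic.
apply: (ler_cvg_to (diff_quotient_cvg df t0 tc vu) ht0).
near=> k; rewrite [_ *: _]mulrC ler_pdivrMr//.
by rewrite -mulrA -expr2 fh.
Unshelve. all: by end_near. Qed.

Theorem theorem5p2 (R : realType) (n m : nat)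
    (f0 : 'rV[R]_n -> R) (F : 'rV[R]_n -> 'rV[R]_m)
    (C : set 'rV[R]_m) (xbar : 'rV[R]_n)
    (f0_C2 : twice_continuously_differentiable f0)
    (F_C2 : twice_continuously_differentiable F)
    (C_closed : closed C)
    (xbar_feasible : C (F xbar))
    (second_order : forall u : 'rV[R]_n,
      critical_cone f0 F C xbar u -> u != 0 ->
      exists alpha : R, exists lambda : 'rV[R]_m,
        [/\ 0 <= alpha,
            multipliers f0 F alpha xbar lambda
          & (0 < (quad_form (hess (lagrangian f0 F alpha ^~ lambda) xbar) u)%:E
               + second_subderivative (indicator C) (F xbar) lambda
                   (u *m 'J F xbar))%E]) :
  essential_local_minimizer2 f0 F C xbar.
Proof.
have [df dpf _] := f0_C2; have [dF dpF _] := F_C2.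
apply: contrapT => ness.
have [u [t [v [y [u0 tc vu t0 seqP]]]]] := violating_sequence xbar_feasible ness.
pose x k := xbar + t k *: v k.
have Cy k : C (y k) by have [] := seqP k.
have f0x k : f0 (x k) - f0 xbar <= harmonic k * t k ^+ 2 by have [] := seqP k.
have Fx k : `|F (x k) - y k| <= harmonic k * t k ^+ 2 by have [] := seqP k.
pose w k := (t k)^-1 *: (y k - F xbar).
have yE k : F xbar + t k *: w k = y k.
  by rewrite scalerA divff ?gt_eqF// scale1r addrC subrK.
have wc : w @ \oo --> u *m 'J F xbar.
  by rewrite -deriveEjacobian//; exact: (tangent_direction_cvg (dF xbar) t0 tc vu).
have u_critical : critical_cone f0 F C xbar u.
  split; last by rewrite dot_grad//; exact: derive_le0 (df xbar) t0 tc vu f0x.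
  by exists t, w; split => // k; rewrite yE.
have [a [l [a0 al]]] := second_order u u_critical u0.
set L := lagrangian f0 F a ^~ l in al *.
set q := quad_form _ _; rewrite -lteBlDl// sub0e => qd.
have [c qc cP] := second_subderivative_gt qd t0 tc wc.
have dL z : differentiable L z by exact: lagrangian_diff.
have dpL i : differentiable (partial i L) xbar.
  by rewrite partial_lagrangian//; exact: lagrangian_diff.
have Lc := second_order_quotient_cvg dL dpL al t0 tc vu.
pose K := \sum_i `|l 0 i|.
have hc : (fun k => 2 * (a + K) * harmonic k - c) @ \oo --> - c.
  rewrite -[X in _ --> X]sub0r -(mulr0 (2 * (a + K))).
  apply: cvgB; last exact: cvg_cst.
  by apply: cvgM; [exact: cvg_cst|exact: cvg_harmonic].
suff : q <= - c by rewrite lerNr leNgt qc.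
apply: (ler_cvg_to Lc hc); near=> k.
have t2 : 0 < 2^-1 * t k ^+ 2 by rewrite mulr_gt0 ?exprn_gt0.
rewrite ler_pdivrMr//.
(* As [y k] and [F xbar] lie in [C], both indicator terms vanish. *)
have : (c%:E <= (- (t k * dot l (w k)) / (2^-1 * t k ^+ 2))%:E)%E.
  rewrite EFinM EFinN -[X in (X * _)%E]add0e.
  have <- : (indicator C (y k) - indicator C (F xbar) = 0)%E.
    by rewrite /indicator !mem_set// sube0.
  by rewrite -(yE k); near: k; exact: cP.
rewrite lee_fin ler_pdivlMr// => ctw.
(* Here [alpha >= 0] turns the bound on [f0] into one on [alpha * f0]. *)
have aK : a * (f0 (x k) - f0 xbar) + dot l (F (x k) - y k)
    <= (a + K) * (harmonic k * t k ^+ 2).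
  rewrite mulrDl lerD ?ler_wpM2l//.
  apply: le_trans (ler_norm _) _; apply: le_trans (normr_dot_le _ _) _.
  by rewrite ler_wpM2l// sumr_ge0.
have -> : L (x k) - L xbar = a * (f0 (x k) - f0 xbar)
    + dot l (F (x k) - y k) + t k * dot l (w k).
  have -> : t k * dot l (w k) = dot l (y k - F xbar).
    by rewrite -(yE k) addrC addKr [RHS]linearZ.
  by rewrite !linearB /L /lagrangian; ring.
lra.
Unshelve. all: by end_near. Qed.
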